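(* Let $\mathbb{S}$ and $\mathbb{T}$ be filtered simplicial complexes with vertex sets $X$ and $Y$ respectively, let $\varepsilon\in\mathbf{R}$, and let $C : X \rightrightarrows Y$ be an $\varepsilon$-simplicial multivalued map from $\mathbb{S}$ to $\mathbb{T}$. Then $C$ induces a canonical linear map $\mathrm{H}(C) \in \mathrm{Hom}^{\varepsilon}(\mathrm{H}(\mathbb{S}),\mathrm{H}(\mathbb{T}))$, equal to $\mathrm{H}(f)$ for any map $f:X\to Y$ subordinate to $C$. (That is: every $f$ subordinate to $C$ induces a homomorphism $\mathrm{H}(f)\in \mathrm{Hom}^{\varepsilon}(\mathrm{H}(\mathbb{S}),\mathrm{H}(\mathbb{T}))$, and $\mathrm{H}(f)$ does not depend on the choice of $f$.)
   Context: Fix a field $\mathbf{k}$; all vector spaces are over $\mathbf{k}$ and $\mathrm{H}$ denotes (total) simplicial homology with coefficients in $\mathbf{k}$. A persistence module $\mathbb{V}$ is a family of vector spaces $(V_a)_{a\in\mathbf{R}}$ with linear maps $v_a^b:V_a\to V_b$ for $a\le b$ such that $v_a^a=\mathrm{id}$ and $v_b^c\circ v_a^b=v_a^c$ for $a\le b\le c$. For real $\varepsilon$, $\mathrm{Hom}^\varepsilon(\mathbb{U},\mathbb{V})$ is the set of homomorphisms of degree $\varepsilon$, i.e. families of linear maps $(\phi_a:U_a\to V_{a+\varepsilon})_{a\in\mathbf{R}}$ with $v_{a+\varepsilon}^{b+\varepsilon}\circ\phi_a=\phi_b\circ u_a^b$ for all $a\le b$. A filtered simplicial complex $\mathbb{S}$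 with vertex set $X$ is a family $(\mathbb{S}_a)_{a\in\mathbf{R}}$ of subcomplexes of a fixed simplicial complex on the vertex set $X$ with $\mathbb{S}_a\subseteq\mathbb{S}_b$ whenever $a\le b$ (simplices are nonempty finite subsets of $X$). Its persistent homology $\mathrm{H}(\mathbb{S})$ is the persistence module $(\mathrm{H}(\mathbb{S}_a))_a$ with maps induced by inclusions. A multivalued map $C:X\rightrightarrows Y$ is a subset $C\subseteq X\times Y$ that projects surjectively onto $X$. For $\sigma\subseteq X$, $C(\sigma)=\{y\in Y: \exists x\in\sigma,\ (x,y)\in C\}$. A map $f:X\to Y$ is subordinate to $C$ if $(x,f(x))\in C$ for every $x\in X$. $C$ is $\varepsilon$-simplicial from $\mathbb{S}$ to $\mathbb{T}$ if for every $a\in\mathbf{R}$ and every simplex $\sigma\in\mathbb{S}_a$, every (nonempty) finite subset of $C(\sigma)$ is a simplex of $\mathbb{T}_{a+\varepsilon}$. If a map $f:X\to Y$ sends every simplex of $\mathbb{S}_a$ to a simplex of $\mathbb{T}_{a+\varepsilon}$ for all $a$, then $\mathrm{H}(f)$ denotes the family of maps $\mathrm{H}(\mathbb{S}_a)\to\mathrm{H}(\mathbb{T}_{a+\varepsilon})$ induced by the simplicial maps $f:\mathbb{S}_a\to\mathbb{T}_{a+\varepsilon}$. *)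

(* Defs.v *)
From HB Require Import structures.
From mathcomp Require Import all_boot all_order all_algebra.
From mathcomp Require Import finmap.
From mathcomp Require Import boolp classical_sets reals.
From mathcomp Require Import freeg.
From mathcomp Require Import zify.

Set Implicit Arguments.
Unset Strict Implicit.
Unset Printing Implicit Defensive.

Import Order.TTheory GRing.Theory Num.Theory.

Local Open Scope classical_set_scope.
Local Open Scope quotient_scope.
Local Open Scope ring_scope.

Section LinearAlgebra.
Variable k : fieldType.

Section Span.
Variable V : lmodType k.

Definition span (G : set V) : {pred V} :=
  [pred v | `[< exists2 s : seq (k * V), {in s, forall p, G p.2} &
                v = \sum_(p <- s) p.1 *: p.2 >]].

Lemma span_submod_closed G : submod_closed (span G).
Proof.
split.
  by rewrite inE; exists [::]; rewrite ?big_nil.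
move=> a u v; rewrite !inE => -[s sG ->] [r rG ->].
exists ([seq (a * p.1, p.2) | p <- s] ++ r).
  by move=> p; rewrite mem_cat => /orP[/mapP[q /sG Gq ->]|/rG].
rewrite big_cat big_map /=; congr (_ + _)%R.
by rewrite scaler_sumr; apply: eq_bigr => p _; rewrite scalerA.
Qed.

HB.instance Definition _ G :=
  GRing.isSubmodClosed.Build k V (span G) (span_submod_closed G).

Lemma mem_span (G : set V) v : G v -> v \in span G.
Proof.
move=> Gv; rewrite inE; exists [:: (1, v)].
  by move=> p; rewrite inE => /eqP->.
by rewrite big_seq1 scale1r.
Qed.

End Span.

Lemma span_linear (V U : lmodType k) (f : {linear V -> U}) (G : set V)
    (W : submodClosed U) :
  (forall v, G v -> f v \in W) -> forall v, v \in span G -> f v \in W.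
Proof.
move=> GW v; rewrite inE => -[s sG ->].
rewrite linear_sum big_seq; apply: rpred_sum => p /sG Gp.
by rewrite linearZ; apply: rpredZ; apply: GW.
Qed.

Lemma span_ker (V U : lmodType k) (f : {linear V -> U}) (G : set V) :
  (forall v, G v -> f v = 0) -> forall v, v \in span G -> f v = 0.
Proof.
move=> G0 v; rewrite inE => -[s sG ->].
rewrite linear_sum big_seq big1 // => p /sG Gp.
by rewrite linearZ /= G0 // scaler0.
Qed.

Definition subspace (V : lmodType k) (W : submodClosed V) := {v : V | v \in W}.

HB.instance Definition _ (V : lmodType k) (W : submodClosed V) :=
  SubChoice.on (subspace W).
HB.instance Definition _ (V : lmodType k) (W : submodClosed V) :=
  [SubChoice_isSubLmodule of subspace W by <:].

(* [submodClosed] does not inherit from [zmodClosed], which the library's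
   quotient construction requires. *)
Definition submod_pred (V : lmodType k) (W : submodClosed V) : {pred V} := W.

Lemma submod_pred_zmod_closed (V : lmodType k) (W : submodClosed V) :
  zmod_closed (submod_pred W).
Proof.
split=> [|u v uW vW]; first exact: (rpred0 W).
rewrite -scaleN1r; change (u + -1 *: v \in W).
by apply: rpredD => //; apply: rpredZ.
Qed.
HB.instance Definition _ (V : lmodType k) (W : submodClosed V) :=
  GRing.isZmodClosed.Build V (submod_pred W) (submod_pred_zmod_closed W).

Definition quotient (V : lmodType k) (W : submodClosed V) :=
  Quotient.quot (submod_pred W).

Section QuotientSpace.
Variables (V : lmodType k) (W : submodClosed V).

HB.instance Definition _ := GRing.Zmodule.on (quotient W).

Definition proj (v : V) : quotient W := \pi_(Quotient.quot (submod_pred W)) v.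

Lemma projP u v : reflect (proj u = proj v) (u - v \in W).
Proof.
by rewrite -[_ \in W]/(_ \in submod_pred W) Quotient.idealrBE; apply: eqP.
Qed.

Lemma proj_repr (q : quotient W) :
  proj (repr (q : Quotient.quot (submod_pred W))) = q.
Proof. exact: reprK. Qed.

Lemma projD : {morph proj : u v / u + v}.
Proof. by move=> u v; apply: (raddfD \pi_(Quotient.quot (submod_pred W))). Qed.

Definition qscale (a : k) (q : quotient W) : quotient W :=
  proj (a *: repr (q : Quotient.quot (submod_pred W))).

Lemma qscaleE a v : qscale a (proj v) = proj (a *: v).
Proof.
by apply/projP; rewrite -scalerBr; apply: rpredZ; apply/projP; rewrite proj_repr.
Qed.

Lemma qscaleA a b q : qscale a (qscale b q) = qscale (a * b) q.
Proof. by rewrite -[q]proj_repr !qscaleE scalerA. Qed.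
Lemma qscale1 : left_id 1 qscale.
Proof. by move=> q; rewrite -[q]proj_repr qscaleE scale1r. Qed.
Lemma qscaleDr : right_distributive qscale +%R.
Proof.
move=> a q r; rewrite -[q]proj_repr -[r]proj_repr -projD !qscaleE -projD.
by rewrite scalerDr.
Qed.
Lemma qscaleDl q : {morph qscale^~ q : a b / a + b}.
Proof. by move=> a b; rewrite -[q]proj_repr !qscaleE -projD scalerDl. Qed.

HB.instance Definition _ := GRing.Zmodule_isLmodule.Build k (quotient W)
  qscaleA qscale1 qscaleDr qscaleDl.

Lemma proj_is_linear : linear proj.
Proof. by move=> a u v; rewrite projD -qscaleE. Qed.
HB.instance Definition _ :=
  GRing.isLinear.Build k V (quotient W) _ proj proj_is_linear.

Lemma proj_eq0 v : (proj v = 0) <-> (v \in W).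
Proof.
rewrite -(linear0 proj); split => [/projP|vW]; first by rewrite subr0.
by apply/projP; rewrite subr0.
Qed.

End QuotientSpace.

Section QuotientLift.
Variables (V : lmodType k) (W : submodClosed V) (U : lmodType k).
Variables (f : {linear V -> U}) (fW : forall v, v \in W -> f v = 0).

Definition quotient_lift of (forall v, v \in W -> f v = 0) :
  quotient W -> U := fun q => f (repr (q : Quotient.quot (submod_pred W))).

Lemma quotient_liftE v : quotient_lift fW (proj W v) = f v.
Proof.
apply/eqP; rewrite -subr_eq0 -linearB; apply/eqP/fW/projP.
by rewrite proj_repr.
Qed.

Lemma quotient_lift_is_linear : linear (quotient_lift fW).
Proof.
move=> a q r; rewrite -[q]proj_repr -[r]proj_repr -linearP !quotient_liftE.
by rewrite linearP.
Qed.
HB.instance Definition _ := GRing.isLinear.Build k (quotient W) U _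
  (quotient_lift fW) quotient_lift_is_linear.

End QuotientLift.

Lemma fglift_is_linear (T : choiceType) (U : lmodType k) (f : T -> U) :
  linear (fglift f : {freeg T / k} -> U).
Proof.
suff fgE D : fglift f D = \sum_(x <- dom D) coeff x D *: f x.
  have fgE' r (D : {freeg T / k}) : uniq r -> {subset dom D <= r} ->
      fglift f D = \sum_(x <- r) coeff x D *: f x.
    move=> ur sub; rewrite fgE [RHS](bigID (mem (dom D))) /=.
    rewrite [X in _ + X]big1 ?addr0 => [|x xD]; last first.
      by rewrite coeff_outdom // scale0r.
    rewrite -[RHS]big_filter; apply: perm_big; apply: uniq_perm.
    - exact: uniq_dom.
    - exact: filter_uniq.
    - move=> x; rewrite mem_filter /=; case xD: (x \in dom D) => //=.
      by rewrite sub.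
  move=> a D E; pose r := undup (dom D ++ dom E ++ dom (a *: D + E)).
  have ur : uniq r by exact: undup_uniq.
  have sub F : F \in [:: D; E; a *: D + E] -> {subset dom F <= r}.
    rewrite !inE => /or3P[] /eqP-> x xF.
    - by rewrite mem_undup !mem_cat xF.
    - by rewrite mem_undup !mem_cat xF orbT.
    - by rewrite mem_undup !mem_cat xF !orbT.
  rewrite !(fgE' r) //; do ?by apply: sub; rewrite !inE eqxx ?orbT.
  rewrite scaler_sumr -big_split /=; apply: eq_bigr => x _.
  by rewrite coeffD coeffZ scalerDl scalerA.
rewrite -{1}(Freeg_dom D) fglift_Freeg /prelift big_map.
by apply: eq_bigr.
Qed.
HB.instance Definition _ (T : choiceType) (U : lmodType k) (f : T -> U) :=
  GRing.isLinear.Build k {freeg T / k} U _ (fglift f) (fglift_is_linear f).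

Lemma fgliftU (T : choiceType) (U : lmodType k) (f : T -> U) x :
  fglift f (<< x >> : {freeg T / k}) = f x.
Proof. by rewrite liftU scale1r. Qed.

Lemma freeg_linear_ext (T : choiceType) (U : lmodType k)
    (f g : {linear {freeg T / k} -> U}) :
  (forall x, f << x >> = g << x >>) -> f =1 g.
Proof.
move=> fg D; rewrite -(freeg_sumE D) !linear_sum; apply: eq_bigr => x _.
have -> : << coeff x D *g x >> = coeff x D *: (<< x >> : {freeg T / k}).
  by apply/eqP/freeg_eqP => y; rewrite coeffZ !coeffU mul1r.
by rewrite !linearZ fg.
Qed.

End LinearAlgebra.

Record complex (X : choiceType) := Complex {
  simplex :> {fset X} -> Prop;
  simplex_neq0 : forall s, simplex s -> s != fset0;
  simplex_face : forall s t, simplex s -> t != fset0 -> (t `<=` s)%fset ->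
    simplex t
}.

Definition subcomplex (X : choiceType) (K L : complex X) :=
  forall s, K s -> L s.

Definition simplicial (X Y : choiceType) (K : complex X) (L : complex Y)
  (f : X -> Y) := forall s, K s -> L [fset f x | x in s]%fset.

Section OrientedChains.
Variables (k : fieldType) (X : choiceType).

Local Notation free := {freeg (seq X) / k}.

(* Reordering the vertices acts by the sign of the permutation (it suffices to
   require this for adjacent transpositions) and degenerate simplices vanish. *)
Variant orientation_relation : set free :=
| OrientSwap s1 x y s2 : orientation_relation
    (<< s1 ++ x :: y :: s2 >> + << s1 ++ y :: x :: s2 >>)
| OrientDegenerate t of ~~ uniq t : orientation_relation << t >>.

Definition orientation : {pred free} := span orientation_relation.
HB.instance Definition _ := GRing.SubmodClosed.on orientation.

(* All degrees at once: [osimplex [:: v_0; ...; v_p]] is the oriented p-simplex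
   [v_0, ..., v_p].  The empty sequence is excluded later on, as it spans no
   simplex of any complex. *)
Definition ochain := quotient orientation.
HB.instance Definition _ := GRing.Lmodule.on ochain.

Definition osimplex (t : seq X) : ochain := proj orientation << t >>.

Definition face_sum (t : seq X) : free :=
  \sum_(i < size t) (-1) ^+ i *: << take i t ++ drop i.+1 t >>.

(* The complex is not augmented: a vertex has boundary 0. *)
Definition boundary_gen (t : seq X) : ochain :=
  if (size t <= 1)%N then 0 else proj orientation (face_sum t).

Definition cone x : free -> free := fglift (fun t => << x :: t >>).
HB.instance Definition _ x := GRing.Linear.on (cone x).

Lemma coneU x t : cone x << t >> = << x :: t >>.
Proof. exact: fgliftU. Qed.

Lemma face_sum_cons x s :
  face_sum (x :: s) = << s >> - cone x (face_sum s).
Proof.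
rewrite /face_sum big_ord_recl /= expr0 scale1r drop0; congr (_ + _)%R.
rewrite linear_sum -sumrN; apply: eq_bigr => i _.
by rewrite linearZ /= coneU /bump /= add1n exprS mulN1r scaleNr.
Qed.

Lemma cone_orientation x c : c \in orientation -> cone x c \in orientation.
Proof.
apply: span_linear => _ [s1 y z s2|t ut].
  rewrite /= linearD /= !coneU.
  exact/mem_span/(OrientSwap (x :: s1)).
rewrite /= coneU; apply/mem_span/OrientDegenerate.
by rewrite /= negb_and ut orbT.
Qed.

Lemma cone_swap x y c : cone x (cone y c) + cone y (cone x c) \in orientation.
Proof.
rewrite -(freeg_sumE c) !linear_sum -big_split; apply: rpred_sum => t _.
have -> : << coeff t c *g t >> = coeff t c *: (<< t >> : free).
  by apply/eqP/freeg_eqP => u; rewrite coeffZ !coeffU mul1r.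
rewrite !linearZ /= !coneU -scalerDr; apply: rpredZ.
exact/mem_span/(OrientSwap [::]).
Qed.

Lemma face_sum_swap s1 x y s2 :
  face_sum (s1 ++ x :: y :: s2) + face_sum (s1 ++ y :: x :: s2) \in orientation.
Proof.
elim: s1 => [|z s1 IH] /=.
  rewrite !face_sum_cons ![cone _ (_ - _)]linearB /= !coneU.
  set a := << y :: s2 >>; set b := << x :: s2 >>.
  set c := cone x _; set d := cone y _.
  have -> : a - (b - c) + (b - (a - d)) = c + d.
    by rewrite !opprB addrACA [c - b + _]addrACA -opprD [b + a]addrC addrC subrK.
  exact: cone_swap.
rewrite !face_sum_cons addrACA -opprD -linearD.
apply: rpredB; last exact: cone_orientation.
exact/mem_span/OrientSwap.
Qed.

Lemma cone_dup x c : cone x (cone x c) \in orientation.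
Proof.
rewrite -(freeg_sumE c) !linear_sum; apply: rpred_sum => t _.
have -> : << coeff t c *g t >> = coeff t c *: (<< t >> : free).
  by apply/eqP/freeg_eqP => u; rewrite coeffZ !coeffU mul1r.
rewrite !linearZ /= !coneU; apply: rpredZ.
by apply/mem_span/OrientDegenerate; rewrite /= inE eqxx.
Qed.

Lemma face_sum_degenerate t : ~~ uniq t -> face_sum t \in orientation.
Proof.
elim: t => [//|z s IH] /=; rewrite negb_and negbK => /orP[|us]; last first.
  rewrite face_sum_cons; apply: rpredB; last exact/cone_orientation/IH.
  exact/mem_span/OrientDegenerate.
case/splitPr => s1 s2; rewrite face_sum_cons.
elim: s1 => [|w s1 IHs] /=.
  rewrite face_sum_cons [cone _ (_ - _)]linearB /= coneU opprB addrC subrK.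
  exact: cone_dup.
rewrite face_sum_cons [cone z (_ - _)]linearB /= coneU.
set F := face_sum _ in IHs *; set a := << w :: _ >>; set b := << z :: _ >>.
have -> : a - (b - cone z (cone w F)) =
    cone w (<< s1 ++ z :: s2 >> - cone z F) - b +
    (cone z (cone w F) + cone w (cone z F)).
  rewrite [cone w (_ - _)]linearB /= coneU -/a opprB.
  set c := cone z _; set d := cone w _.
  by rewrite [c + d]addrC addrACA subrK [- b + c]addrC.
apply: rpredD; last exact: cone_swap.
apply: rpredB; first exact: cone_orientation.
by apply/mem_span/OrientDegenerate; rewrite /= mem_cat inE eqxx orbT.
Qed.

Lemma boundary_gen_orientation (c : free) :
  c \in orientation -> fglift boundary_gen c = 0.
Proof.
apply: span_ker => _ [s1 x y s2|t ut].
  rewrite linearD /= !fgliftU /boundary_gen !size_cat /= !addnS !ltnS leqn0.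
  by rewrite -linearD; apply/proj_eq0/face_sum_swap.
rewrite /= fgliftU /boundary_gen; case: leqP => // _.
exact/proj_eq0/face_sum_degenerate.
Qed.

Definition boundary : ochain -> ochain :=
  quotient_lift boundary_gen_orientation.
HB.instance Definition _ := GRing.Linear.on boundary.

Lemma boundaryE t : boundary (osimplex t) = boundary_gen t.
Proof. by rewrite /boundary /osimplex quotient_liftE /= fgliftU. Qed.

Lemma face_sum_face_sum t : fglift face_sum (face_sum t) = 0.
Proof.
have face_cone x c : fglift face_sum (cone x c) = c - cone x (fglift face_sum c).
  apply/eqP; rewrite -subr_eq0; apply/eqP.
  pose F := GRing.sub_fun (fglift face_sum \o cone x)
    (GRing.sub_fun idfun (cone x \o fglift face_sum)).
  rewrite -[LHS]/(F c) -[RHS]/((\0 : free -> free) c).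
  apply: freeg_linear_ext => s.
  by rewrite /= /F /GRing.sub_fun /= coneU !fgliftU face_sum_cons subrr.
elim: t => [|x t IH]; first by rewrite /face_sum big_ord0 linear0.
by rewrite face_sum_cons linearB /= fgliftU face_cone IH linear0 subr0 subrr.
Qed.

Lemma boundary_boundary c : boundary (boundary c) = 0.
Proof.
rewrite -[c]proj_repr; move: (repr _) => {}c.
rewrite -[RHS]/((\0 : free -> ochain) c).
apply: (@freeg_linear_ext k _ _ (boundary \o boundary \o proj _)) => t /=.
rewrite -/(osimplex t) boundaryE /boundary_gen.
case: leqP => [_|t2]; first by rewrite linear0.
transitivity (proj orientation (fglift face_sum (face_sum t))); last first.
  by rewrite face_sum_face_sum linear0.
have [t3|t3] := leqP (size t) 2.
  case: t t2 t3 => [|x [|y [|//]]] // _ _.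
  rewrite face_sum_face_sum linear0 /face_sum !linear_sum big1 // => i _.
  by rewrite !linearZ /= -/(osimplex _) boundaryE; case: i => -[|[|]] //= _;
     rewrite /boundary_gen /= scaler0.
rewrite {1 3}/face_sum !linear_sum; apply: eq_bigr => i _.
rewrite !linearZ /= -/(osimplex _) boundaryE fgliftU /boundary_gen.
rewrite size_cat size_takel ?size_drop; last exact: ltnW.
case: leqP => // ; rewrite leqNgt => /negP[].
by have := ltn_ord i; lia.
Qed.

Section Homology.
Variable K : complex X.

Definition osimplices : set ochain :=
  [set osimplex t | t in [set t : seq X | K [fset x in t]%fset]].

Definition cycles : {pred ochain} :=
  [pred c | (c \in span osimplices) && (boundary c == 0)].

Lemma in_cycles c :
  (c \in cycles) = (c \in span osimplices) && (boundary c == 0).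
Proof. by []. Qed.

Lemma cycles_submod_closed : submod_closed cycles.
Proof.
split; first by rewrite in_cycles rpred0 linear0 eqxx.
move=> a c d; rewrite !in_cycles => /andP[Kc /eqP bc] /andP[Kd /eqP bd].
by rewrite linearP /= bc bd scaler0 addr0 eqxx andbT rpredD ?rpredZ.
Qed.
HB.instance Definition _ :=
  GRing.isSubmodClosed.Build k ochain cycles cycles_submod_closed.

Definition boundaries : {pred subspace cycles} :=
  [pred z | `[< exists2 c, c \in span osimplices & boundary c = val z >]].

Lemma boundariesP z :
  reflect (exists2 c, c \in span osimplices & boundary c = val z)
          (z \in boundaries).
Proof. exact: asboolP. Qed.

Lemma boundaries_submod_closed : submod_closed boundaries.
Proof.
split; first by apply/boundariesP; exists 0; rewrite ?rpred0 ?linear0.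
move=> a y z /boundariesP[c Kc bc] /boundariesP[d Kd bd]; apply/boundariesP.
by exists (a *: c + d); rewrite ?rpredD ?rpredZ // !linearP /= bc bd.
Qed.
HB.instance Definition _ :=
  GRing.isSubmodClosed.Build k (subspace cycles) boundaries
    boundaries_submod_closed.

(* The total homology, i.e. the direct sum of the homology in all degrees. *)
Definition homology := quotient boundaries.
HB.instance Definition _ := GRing.Lmodule.on homology.

End Homology.

End OrientedChains.

Arguments orientation k X : clear implicits.
Arguments osimplex k {X} t.
Arguments osimplices k {X} K.
Arguments cycles k {X} K.
Arguments boundaries k {X} K.
Arguments homology k {X} K.

Section InducedMaps.
Variables (k : fieldType) (X Y : choiceType).

Section ChainMap.
Variable f : X -> Y.

Definition chain_gen (t : seq X) : ochain k Y := osimplex k (map f t).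

Lemma chain_gen_orientation (c : {freeg (seq X) / k}) :
  c \in orientation k X -> fglift chain_gen c = 0.
Proof.
apply: span_ker => _ [s1 x y s2|t ut].
  rewrite linearD /= !fgliftU /chain_gen /osimplex !map_cat /= -linearD.
  exact/proj_eq0/mem_span/OrientSwap.
rewrite /= fgliftU; apply/proj_eq0/mem_span/OrientDegenerate.
by apply: contra ut => /map_uniq.
Qed.

Definition chain_map : ochain k X -> ochain k Y :=
  quotient_lift chain_gen_orientation.
HB.instance Definition _ := GRing.Linear.on chain_map.

Lemma chain_mapE t : chain_map (osimplex k t) = osimplex k (map f t).
Proof. by rewrite /chain_map {1}/osimplex quotient_liftE /= fgliftU. Qed.

Lemma boundary_chain_map c : boundary (chain_map c) = chain_map (boundary c).
Proof.
rewrite -[c]proj_repr; move: (repr _) => {}c.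
apply: (@freeg_linear_ext k _ _ (@boundary k Y \o chain_map \o proj _)
  (chain_map \o @boundary k X \o proj _)) => t /=.
rewrite -/(osimplex k t) chain_mapE !boundaryE /boundary_gen size_map.
case: ifP => _; first by rewrite linear0.
rewrite /face_sum size_map !linear_sum; apply: eq_bigr => i _.
rewrite !linearZ /= -!/(osimplex k _) chain_mapE.
by rewrite map_cat map_take map_drop.
Qed.

Variables (K : complex X) (L : complex Y) (fKL : simplicial K L f).

Lemma chain_map_span c :
  c \in span (osimplices k K) -> chain_map c \in span (osimplices k L).
Proof.
apply: span_linear => _ [t Kt <-]; rewrite /= chain_mapE.
apply: mem_span; exists (map f t) => //=.
have -> : [fset y in map f t]%fset = [fset f x | x in [fset x in t]]%fset.
  apply/fsetP => y; rewrite inE; apply/mapP/imfsetP => -[x /= xt ->];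
  by exists x; rewrite ?inE // in xt *.
exact: fKL.
Qed.

Lemma chain_map_cycles c : c \in cycles k K -> chain_map c \in cycles k L.
Proof.
rewrite !in_cycles => /andP[/chain_map_span -> /eqP bc].
by rewrite boundary_chain_map bc linear0 eqxx.
Qed.

Definition cycle_map (z : subspace (cycles k K)) : subspace (cycles k L) :=
  exist _ (chain_map (val z)) (chain_map_cycles (valP z)).

Lemma cycle_map_is_linear : linear cycle_map.
Proof. by move=> a y z; apply/val_inj; rewrite /= linearP. Qed.
HB.instance Definition _ := GRing.isLinear.Build k (subspace (cycles k K))
  (subspace (cycles k L)) _ cycle_map cycle_map_is_linear.

Lemma cycle_map_boundaries z :
  z \in boundaries k K -> proj (boundaries k L) (cycle_map z) = 0.
Proof.
move=> /boundariesP[c Kc bc]; apply/proj_eq0/boundariesP.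
by exists (chain_map c); rewrite ?chain_map_span // boundary_chain_map bc.
Qed.

Definition homology_map : homology k K -> homology k L :=
  @quotient_lift k _ (boundaries k K) _
    (proj (boundaries k L) \o cycle_map) cycle_map_boundaries.
HB.instance Definition _ := GRing.Linear.on homology_map.

Lemma homology_mapE z :
  homology_map (proj (boundaries k K) z) = proj (boundaries k L) (cycle_map z).
Proof. exact: quotient_liftE. Qed.

End ChainMap.
End InducedMaps.

Section Functoriality.
Variable k : fieldType.

Lemma homology_map_comp (X Y Z : choiceType) (K : complex X) (L : complex Y)
    (M : complex Z) (f : X -> Y) (g : Y -> Z) (h : X -> Z)
    (fKL : simplicial K L f) (gLM : simplicial L M g) (hKM : simplicial K M h) :
  h =1 g \o f ->
  forall x : homology k K,
    homology_map gLM (homology_map fKL x) = homology_map hKM x.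
Proof.
move=> hgf x; rewrite -[x]proj_repr !homology_mapE; congr proj.
apply/val_inj => /=; move: (val _) => c; rewrite -[c]proj_repr.
move: (repr _) => {}c.
apply: (@freeg_linear_ext k _ _ (@chain_map k _ _ g \o @chain_map k _ _ f \o proj _)
  (@chain_map k _ _ h \o proj _)) => t /=.
by rewrite -/(osimplex k t) !chain_mapE -map_comp (eq_map hgf).
Qed.

Lemma homology_map_id (X : choiceType) (K : complex X) (f : X -> X)
    (fK : simplicial K K f) :
  f =1 id -> forall x : homology k K, homology_map fK x = x.
Proof.
move=> fid x; rewrite -[x]proj_repr homology_mapE; congr proj.
apply/val_inj => /=; move: (val _) => c; rewrite -[c]proj_repr.
move: (repr _) => {}c.
apply: (@freeg_linear_ext k _ _ (@chain_map k _ _ f \o proj _) (proj _)) => t /=.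
by rewrite -/(osimplex k t) chain_mapE (eq_map fid) map_id.
Qed.

End Functoriality.

Lemma simplicial_id (X : choiceType) (K L : complex X) :
  subcomplex K L -> simplicial K L id.
Proof. by move=> KL s /KL; rewrite imfset_id. Qed.

Record persistence_module (k : fieldType) (R : realType) := PersistenceModule {
  pm_space :> R -> lmodType k;
  pm_map : forall a b, a <= b -> {linear pm_space a -> pm_space b};
  pm_map_id : forall a (aa : a <= a) x, pm_map aa x = x;
  pm_map_comp : forall a b c (ab : a <= b) (bc : b <= c) (ac : a <= c) x,
    pm_map bc (pm_map ab x) = pm_map ac x
}.

Record pm_hom (k : fieldType) (R : realType) (eps : R)
  (U V : persistence_module k R) := PmHom {
  pm_hom_map :> forall a, {linear U a -> V (a + eps)};
  pm_hom_natural : forall a b (ab : a <= b) (abe : a + eps <= b + eps) x,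
    pm_map V abe (pm_hom_map a x) = pm_hom_map b (pm_map U ab x)
}.

Record filtered_complex (R : realType) (X : choiceType) := FilteredComplex {
  filtration :> R -> complex X;
  ambient : complex X;
  filtration_ambient : forall a, subcomplex (filtration a) ambient;
  filtration_mono : forall a b, a <= b ->
    subcomplex (filtration a) (filtration b)
}.

Section PersistentHomology.
Variables (k : fieldType) (R : realType) (X : choiceType).
Variable S : filtered_complex R X.

Definition inclusion_map a b (ab : a <= b) :
    {linear homology k (S a) -> homology k (S b)} :=
  homology_map (simplicial_id (filtration_mono ab)).

Lemma inclusion_map_id a (aa : a <= a) x : inclusion_map aa x = x.
Proof. exact: homology_map_id. Qed.

Lemma inclusion_map_comp a b c (ab : a <= b) (bc : b <= c) (ac : a <= c) x :
  inclusion_map bc (inclusion_map ab x) = inclusion_map ac x.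
Proof. exact: homology_map_comp. Qed.

Definition persistent_homology : persistence_module k R :=
  PersistenceModule inclusion_map_id inclusion_map_comp.

End PersistentHomology.

Arguments persistent_homology k {R X} S.

Section MultivaluedMaps.
Variables (X Y : choiceType).

Definition multivalued (C : set (X * Y)) := forall x, exists y, C (x, y).

Definition mv_image (C : set (X * Y)) (s : set X) : set Y :=
  [set y | exists2 x, s x & C (x, y)].

Definition subordinate (C : set (X * Y)) (f : X -> Y) :=
  forall x, C (x, f x).

Definition mv_simplicial (R : realType) (eps : R) (S : filtered_complex R X)
  (T : filtered_complex R Y) (C : set (X * Y)) :=
  forall a (s : {fset X}), S a s ->
  forall t : {fset Y}, t != fset0 -> [set` t] `<=` mv_image C [set` s] ->
    T (a + eps) t.

End MultivaluedMaps.

(* Main.v *)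
From HB Require Import structures.
Require Import Defs.
From mathcomp Require Import all_boot all_order all_algebra.
From mathcomp Require Import finmap freeg.
From mathcomp Require Import boolp classical_sets reals.

Set Implicit Arguments.
Unset Strict Implicit.
Unset Printing Implicit Defensive.

Import Order.TTheory GRing.Theory Num.Theory.

Local Open Scope ring_scope.

(** If [f] and [g] are both subordinate to [C] and [s] is a simplex of [S a],
then [f s] and [g s] lie in [C s], so their union is a simplex of
[T (a + eps)]: the maps [f] and [g] are contiguous.  Everything therefore rests
on the classical fact that contiguous maps agree in homology
([contiguous_homology_map]); applied with [f = g] the same remark shows that
[f] is simplicial, and naturality in [a] is functoriality of homology.

The textbook prism sum of (-1)^i [f v_0, ..., f v_i, g v_i, ..., g v_p] depends
on the order of the vertices and does not define a map on oriented chains.  If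
however [f] and [g] differ at a single vertex [x], every oriented simplex
containing [x] can be written with [x] in front, and
[x, v_1, ..., v_p] |-> [g x, f x, f v_1, ..., f v_p] is well defined up to
orientation.  Since a cycle involves finitely many vertices, [f] can be turned
into [g] on all of them by changing one vertex at a time
([contiguous_homologous]); the intermediate maps remain contiguous.

To compute without choosing an order, oriented chains are treated as the
exterior algebra on the vertices.  Adding a vertex in front is [wedge]; a weight
[w] on the vertices defines the antiderivation [contract w].  The augmented
boundary is the contraction with constant weight 1, extraction of the vertex [x]
is the contraction with the indicator weight of [x], and the homotopy formula
([boundary_prism]) follows from the two rules [contract_wedge] and
[contract_swap]. *)

(** * Oriented chains as an exterior algebra *)

Section ExteriorAlgebra.
Variables (k : fieldType) (X : choiceType).
Implicit Types (x y : X) (s t : seq X) (c : ochain k X) (w : X -> k).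

Lemma osimplex_degenerate t : ~~ uniq t -> osimplex k t = 0.
Proof. by move=> ut; apply/proj_eq0/mem_span/OrientDegenerate. Qed.

Lemma osimplex_swap s1 x y s2 :
  osimplex k (s1 ++ x :: y :: s2) = - osimplex k (s1 ++ y :: x :: s2).
Proof.
apply/eqP; rewrite -addr_eq0 -linearD; apply/eqP/proj_eq0.
exact/mem_span/OrientSwap.
Qed.

Lemma ochain_linear_ext (U : lmodType k) (f g : {linear ochain k X -> U}) c :
  (forall t, f (osimplex k t) = g (osimplex k t)) -> f c = g c.
Proof.
move=> fg; rewrite -[c]proj_repr.
exact: (@freeg_linear_ext k _ _ (f \o proj _) (g \o proj _)).
Qed.

Lemma wedge_orientation y (c : {freeg (seq X) / k}) :
  c \in orientation k X -> (proj (orientation k X) \o cone y) c = 0.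
Proof. by move=> oc; apply/proj_eq0/cone_orientation. Qed.

Definition wedge y : ochain k X -> ochain k X :=
  quotient_lift (wedge_orientation y).
HB.instance Definition _ y := GRing.Linear.on (wedge y).

Lemma wedgeE y t : wedge y (osimplex k t) = osimplex k (y :: t).
Proof. by rewrite /wedge /osimplex quotient_liftE /= coneU. Qed.

Lemma wedge0 y : wedge y 0 = 0. Proof. exact: linear0. Qed.
Lemma wedgeD y : {morph wedge y : c d / c + d}. Proof. exact: linearD. Qed.
Lemma wedgeN y : {morph wedge y : c / - c}. Proof. exact: linearN. Qed.
Lemma wedgeB y : {morph wedge y : c d / c - d}. Proof. exact: linearB. Qed.
Lemma wedgeZ y a : {morph wedge y : c / a *: c}. Proof. exact: linearZ. Qed.

Lemma wedge_swap x y c : wedge x (wedge y c) = - wedge y (wedge x c).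
Proof.
change ((wedge x \o wedge y) c = GRing.opp_fun (wedge y \o wedge x) c).
apply: ochain_linear_ext => t /=.
by rewrite !wedgeE (osimplex_swap [::]).
Qed.

Lemma wedge_dup x c : wedge x (wedge x c) = 0.
Proof.
change ((wedge x \o wedge x) c = (\0 : ochain k X -> ochain k X) c).
apply: ochain_linear_ext => t /=.
by rewrite !wedgeE osimplex_degenerate //= inE eqxx.
Qed.

(** This is the alternating sum over [i] of [w v_i] times the [i]-th face;
the recursion is the antiderivation rule. *)
Fixpoint contract_gen w t : ochain k X :=
  if t is y :: s then w y *: osimplex k s - wedge y (contract_gen w s) else 0.

(** By the antiderivation rule the difference of the two sides is the
contraction of [y :: t], which has to vanish since [y] is repeated.
Proving this first is what makes the contraction well defined on degenerate
simplices. *)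
Lemma wedge_contract_gen w y t :
  y \in t -> wedge y (contract_gen w t) = w y *: osimplex k t.
Proof.
elim: t => //= z s IH; rewrite inE wedgeB wedgeZ wedgeE.
case: eqVneq => [<- _|_ /= ys]; first by rewrite wedge_dup subr0.
rewrite wedge_swap IH // wedgeZ wedgeE opprK.
rewrite [osimplex k (y :: s)]osimplex_degenerate; last by rewrite /= ys.
by rewrite scaler0 add0r.
Qed.

Lemma contract_gen_orientation w (c : {freeg (seq X) / k}) :
  c \in orientation k X -> fglift (contract_gen w) c = 0.
Proof.
apply: span_ker => _ [s1 x y s2|t]; last first.
  rewrite /= fgliftU; elim: t => //= y s IH.
  rewrite negb_and negbK.
  case: (boolP (y \in s)) => [/wedge_contract_gen-> _|_].
    by rewrite subrr.
  move=> us; rewrite osimplex_degenerate // IH //.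
  by rewrite wedge0 scaler0 subr0.
rewrite linearD /= !fgliftU; elim: s1 => [|z s1 IH] /=.
  rewrite !wedgeB !wedgeZ !wedgeE (wedge_swap y x).
  by rewrite opprB opprK addrA addrA subrK subrr.
rewrite addrACA -opprD -scalerDr -wedgeD IH wedge0 subr0.
by rewrite osimplex_swap addNr scaler0.
Qed.

Definition contract w : ochain k X -> ochain k X :=
  quotient_lift (contract_gen_orientation w).
HB.instance Definition _ w := GRing.Linear.on (contract w).

Lemma contractE w t : contract w (osimplex k t) = contract_gen w t.
Proof. by rewrite /contract /osimplex quotient_liftE /= fgliftU. Qed.

Lemma contract0 w : contract w 0 = 0. Proof. exact: linear0. Qed.
Lemma contractB w : {morph contract w : c d / c - d}.
Proof. exact: linearB. Qed.
Lemma contractZ w a : {morph contract w : c / a *: c}.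
Proof. exact: linearZ. Qed.

Lemma contract_wedge w y c :
  contract w (wedge y c) = w y *: c - wedge y (contract w c).
Proof.
change ((contract w \o wedge y) c =
  GRing.sub_fun (w y \*: idfun) (wedge y \o contract w) c).
apply: ochain_linear_ext => t /=.
by rewrite /GRing.sub_fun /= wedgeE !contractE.
Qed.

(** Expanding both sides on a wedge [y ^ s] leaves the same terms, up to the
claim for [s]. *)
Lemma contract_swap v w c :
  contract v (contract w c) = - contract w (contract v c).
Proof.
change ((contract v \o contract w) c =
  GRing.opp_fun (contract w \o contract v) c).
apply: ochain_linear_ext => t /=.
elim: t => [|y s IH]; first by rewrite !contractE !contract0 oppr0.
rewrite -wedgeE !contract_wedge !contractB !contractZ !contract_wedge IH.
by rewrite wedgeN opprK opprD opprB addrA addrAC.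
Qed.

(** The contraction with weight 1 is the augmented boundary, in which a vertex
has the empty simplex as boundary; only this version satisfies the
antiderivation rule in all degrees.  The next two lemmas exchange it for
[boundary] where both occur in the homotopy formula. *)
Lemma augmented_boundaryE t :
  contract (fun=> 1) (osimplex k t) = proj (orientation k X) (face_sum k t).
Proof.
rewrite contractE; elim: t => [|x s IH] /=.
  by rewrite /face_sum big_ord0 linear0.
by rewrite scale1r IH face_sum_cons linearB /= /wedge quotient_liftE.
Qed.

(** After two wedges only simplices with at least two vertices occur, and
on those the two boundaries agree. *)
Lemma boundary_wedge2 x y c :
  boundary (wedge x (wedge y c)) = contract (fun=> 1) (wedge x (wedge y c)).
Proof.
change ((@boundary k X \o wedge x \o wedge y) c =
  (contract (fun=> 1) \o wedge x \o wedge y) c).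
apply: ochain_linear_ext => t /=.
by rewrite !wedgeE boundaryE augmented_boundaryE.
Qed.

(** The two boundaries differ by multiples of the empty simplex, which every
contraction kills. *)
Lemma contract_boundary w c :
  contract w (boundary c) = contract w (contract (fun=> 1) c).
Proof.
change ((contract w \o @boundary k X) c =
  (contract w \o contract (fun=> 1)) c).
apply: ochain_linear_ext => t /=.
rewrite boundaryE augmented_boundaryE /boundary_gen; case: ifP => //.
rewrite contract0 -augmented_boundaryE contractE.
case: t => [|y [|//]] _ /=; first by rewrite contract0.
by rewrite wedge0 subr0 scale1r contractE.
Qed.

Lemma contract_gen_eq0 w t : {in t, forall y, w y = 0} -> contract_gen w t = 0.
Proof.
elim: t => //= y s IH w0; rewrite w0 ?mem_head // IH => [|z zs].
  by rewrite scale0r wedge0 subr0.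
by rewrite w0 // inE zs orbT.
Qed.

Lemma contract_gen_span w t :
  contract_gen w t \in
    Defs.span
      [set osimplex k u | u in [set u : seq X | {subset u <= t}]]%classic.
Proof.
elim: t => [|y s IH] /=; first exact: rpred0.
apply: rpredB.
  by apply/rpredZ/mem_span; exists s => //= z zs; rewrite inE zs orbT.
move: IH; apply: span_linear => _ [u us <-]; rewrite /= wedgeE.
apply: mem_span; exists (y :: u) => //= z.
by rewrite !inE => /orP[->//|/us->]; rewrite orbT.
Qed.

End ExteriorAlgebra.

(** * Chain maps *)

Section ChainMaps.
Variables (k : fieldType) (X Y : choiceType) (f : X -> Y).

Lemma chain_map0 : chain_map f (0 : ochain k X) = 0.
Proof. exact: linear0. Qed.
Lemma chain_mapN : {morph @chain_map k X Y f : c / - c}.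
Proof. exact: linearN. Qed.
Lemma chain_mapB : {morph @chain_map k X Y f : c d / c - d}.
Proof. exact: linearB. Qed.
Lemma chain_mapZ a : {morph @chain_map k X Y f : c / a *: c}.
Proof. exact: linearZ. Qed.

Lemma chain_map_wedge y (c : ochain k X) :
  chain_map f (wedge y c) = wedge (f y) (chain_map f c).
Proof.
change ((@chain_map k X Y f \o wedge y) c =
  (wedge (f y) \o @chain_map k X Y f) c).
apply: ochain_linear_ext => t /=.
by rewrite !(wedgeE, chain_mapE).
Qed.

Lemma contract_chain_map w (c : ochain k X) :
  contract w (chain_map f c) = chain_map f (contract (w \o f) c).
Proof.
change ((contract w \o @chain_map k X Y f) c =
  (@chain_map k X Y f \o contract (w \o f)) c).
apply: ochain_linear_ext => t /=; rewrite chain_mapE !contractE.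
elim: t => [|y s IH] /=; first by rewrite chain_map0.
by rewrite chain_mapB chain_mapZ chain_map_wedge chain_mapE IH.
Qed.

End ChainMaps.

(** * Changing a map at one vertex *)

Definition contiguous (X Y : choiceType) (K : complex X) (L : complex Y)
    (f g : X -> Y) :=
  forall s, K s -> L ([fset f x | x in s] `|` [fset g x | x in s])%fset.

Lemma osimplex_in_span (k : fieldType) (Y : choiceType) (L : complex Y)
    (s : {fset Y}) (t : seq Y) :
  L s -> t != [::] -> {subset t <= s} ->
  osimplex k t \in Defs.span (osimplices k L).
Proof.
move=> Ls t0 ts; apply: mem_span; exists t => //=; apply: (simplex_face Ls).
  case: t t0 {ts} => // y t _; apply/fset0Pn; exists y.
  by rewrite !inE eqxx.
by apply/fsubsetP => y; rewrite inE => /ts.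
Qed.

Section VertexChange.
Variables (k : fieldType) (X Y : choiceType) (f g : X -> Y) (x : X).
Hypothesis fg : forall y, y != x -> f y = g y.

Let dx (y : X) : k := (y == x)%:R.

(** The oriented simplex [x, v_1, ..., v_p] goes to
[g x, f x, f v_1, ..., f v_p], and simplices without [x] go to 0. *)
Definition prism (c : ochain k X) : ochain k Y :=
  wedge (g x) (wedge (f x) (chain_map f (contract dx c))).
HB.instance Definition _ := GRing.Linear.copy prism
  (wedge (g x) \o wedge (f x) \o chain_map f \o contract dx).

(** A simplex is, up to orientation, either free of [x], and then [f] and [g]
agree on it, or of the form [x ^ u] with [u] free of [x].  In the latter case
the images are [f x ^ f u] and [g x ^ g u], and [g u = f u].  An induction on
the list of vertices avoids choosing such a form. *)
Lemma chain_map_vertex_change (c : ochain k X) :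
  chain_map f c - chain_map g c =
    wedge (f x) (chain_map f (contract dx c)) -
    wedge (g x) (chain_map f (contract dx c)).
Proof.
pose F := @chain_map k X Y f; pose G := @chain_map k X Y g.
change (GRing.sub_fun F G c = GRing.sub_fun
  (wedge (f x) \o F \o contract dx) (wedge (g x) \o F \o contract dx) c).
apply: ochain_linear_ext => t; rewrite /GRing.sub_fun /= {c}.
elim: t => [|y s IH].
  by rewrite contractE /F /G !chain_mapE subrr chain_map0 !wedge0 subr0.
rewrite -wedgeE contract_wedge /F /G chain_mapB chain_mapZ !chain_map_wedge.
rewrite !wedgeB !wedgeZ -/F -/G.
set Phi := F (contract dx _) in IH *.
case: (eqVneq y x) => [->|yx].
  have -> : G (osimplex k s) = F (osimplex k s) -
      (wedge (f x) Phi - wedge (g x) Phi) by rewrite -IH opprB addrC subrK.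
  by rewrite {1 2}/dx eqxx !scale1r !wedgeB !wedge_dup !subr0.
rewrite -(fg yx) /dx (negPf yx) !scale0r !sub0r opprK.
by rewrite -wedgeB IH wedgeB !(wedge_swap (f y)) opprK.
Qed.

(** Contracting [g x ^ f x ^ f u] with weight 1, where [u] is the contraction of
[c] at [x], strips either [g x] or [f x], which accounts for the two terms of
[chain_map_vertex_change], or acts on [u]; since contractions anticommute, the
last term is the prism over the boundary. *)
Lemma boundary_prism (c : ochain k X) :
  boundary (prism c) = chain_map f c - chain_map g c - prism (boundary c).
Proof.
rewrite chain_map_vertex_change /prism boundary_wedge2 !contract_wedge !scale1r.
rewrite contract_boundary contract_chain_map (contract_swap (fun=> 1)).
by rewrite chain_mapN wedgeB !wedgeN opprB addrA addrAC.
Qed.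

(** A simplex [t] that contributes contains [x], so the vertices [g x], [f x]
and [f v] for [v] in [t] all lie in the union of [f t] and [g t]. *)
Lemma prism_span (K : complex X) (L : complex Y) (c : ochain k X) :
  contiguous K L f g -> c \in Defs.span (osimplices k K) ->
  prism c \in Defs.span (osimplices k L).
Proof.
move=> KL; apply: span_linear => _ [t Kt <-].
rewrite /= /prism contractE; have [xt|xt] := boolP (x \in t); last first.
  rewrite contract_gen_eq0 ?chain_map0 ?wedge0 ?rpred0 // => y yt.
  by rewrite /dx; case: eqP => // yx; rewrite -yx yt in xt.
move: (contract_gen_span dx t).
pose h := [the {linear ochain k X -> ochain k Y} of
  wedge (g x) \o wedge (f x) \o chain_map f].
rewrite -[wedge (g x) _]/(h _); apply: span_linear.
move=> _ [u ut <-] /=; rewrite chain_mapE !wedgeE.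
apply: (osimplex_in_span k (KL _ Kt)) => // y.
rewrite !inE => /or3P[/eqP->|/eqP->|/mapP[z /ut zt ->]]; apply/orP.
- by right; apply/imfsetP; exists x; rewrite ?inE.
- by left; apply/imfsetP; exists x; rewrite ?inE.
- by left; apply/imfsetP; exists z; rewrite ?inE.
Qed.

End VertexChange.

(** * Contiguous maps agree in homology *)

Section Contiguity.
Variables (k : fieldType) (X Y : choiceType).

Lemma chain_map_finite_support (c : ochain k X) :
  exists A : seq X, forall f g : X -> Y, {in A, f =1 g} ->
    chain_map f c = chain_map g c.
Proof.
rewrite -[c]proj_repr; move: (repr _) => {}c.
have sumE h : chain_map h (proj (orientation k X) c) =
    \sum_(t <- dom c) coeff t c *: osimplex k (map (h : X -> Y) t).
  rewrite -{1}(freeg_sumE c) !linear_sum; apply: eq_bigr => t _.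
  have -> : << coeff t c *g t >> = coeff t c *: (<< t >> : {freeg (seq X) / k}).
    by apply/eqP/freeg_eqP => u; rewrite coeffZ !coeffU mul1r.
  by rewrite !linearZ /= -/(osimplex k t) chain_mapE.
exists (flatten (dom c)) => f g fg; rewrite !sumE.
apply: eq_big_seq => t ct; congr (_ *: osimplex k _).
apply/eq_in_map => x xt; apply: fg.
by apply/flattenP; exists t.
Qed.

Definition patch (A : seq X) (f g : X -> Y) x := if x \in A then g x else f x.

(** Patched maps take a simplex into the union of its images under [f] and [g];
this keeps the whole chain of intermediate maps contiguous. *)
Lemma patch_contiguous (K : complex X) (L : complex Y) f g A B :
  contiguous K L f g -> contiguous K L (patch A f g) (patch B f g).
Proof.
move=> KL s Ks; apply: (simplex_face (KL s Ks)).
  have /fset0Pn[x xs] := simplex_neq0 Ks.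
  apply/fset0Pn; exists (patch A f g x).
  by rewrite inE; apply/orP; left; apply/imfsetP; exists x.
apply/fsubsetP => y.
rewrite !inE => /orP[] /imfsetP[x /= xs ->]; rewrite /patch; case: ifP => _;
  by apply/orP; (left + right); apply/imfsetP; exists x.
Qed.

(** Passing from the set [A] to [x :: A] changes the patched map at [x] only,
so the prism over [c] supplies the next summand of [d]. *)
Lemma contiguous_homologous (K : complex X) (L : complex Y) f g A
    (c : ochain k X) :
  contiguous K L f g -> c \in cycles k K ->
  exists2 d, d \in Defs.span (osimplices k L) &
    boundary d = chain_map f c - chain_map (patch A f g) c.
Proof.
move=> KL; rewrite in_cycles => /andP[Kc /eqP bc].
elim: A => [|x A [d Ld bd]].
  by exists 0; rewrite ?rpred0 // linear0 subrr.
have AxA y : y != x -> patch A f g y = patch (x :: A) f g y.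
  by rewrite /patch inE => /negPf->.
exists (d + prism (patch A f g) (patch (x :: A) f g) x c).
  apply: rpredD => //; apply: prism_span Kc; exact: patch_contiguous.
by rewrite linearD /= bd (boundary_prism AxA) bc linear0 subr0 addrA subrK.
Qed.

(** Patching over the finite support of a cycle, the last of the intermediate
maps has the same effect on it as [g]. *)
Lemma contiguous_homology_map (K : complex X) (L : complex Y) f g
    (fKL : simplicial K L f) (gKL : simplicial K L g) :
  contiguous K L f g -> forall z : homology k K,
    homology_map fKL z = homology_map gKL z.
Proof.
move=> KL z; rewrite -[z]proj_repr; move: (repr _) => {}z.
rewrite !homology_mapE; apply/projP/boundariesP.
have [A Ac] := chain_map_finite_support (val z).
have [d Ld bd] := contiguous_homologous A KL (valP z).
exists d; rewrite // bd linearB /=; congr (_ - _).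
by apply: Ac => x xA; rewrite /patch xA.
Qed.

End Contiguity.

(** * Extensionality of homomorphisms *)

(** Linear maps bundle proofs with a function; proof irrelevance identifies
the proofs, which the uniqueness of the induced homomorphism relies on. *)
Lemma linear_map_eq (k : fieldType) (U V : lmodType k)
  (f g : {linear U -> V}) : f =1 g -> f = g.
Proof.
case: f g => [f Pf] [g Pg] /= /funext fg; subst g.
congr GRing.Linear.Pack.
case: Pf Pg => [[p1] [p2]] [[q1] [q2]].
by rewrite (Prop_irrelevance p1 q1) (Prop_irrelevance p2 q2).
Qed.

Lemma pm_hom_eq (k : fieldType) (R : realType) (eps : R)
    (U V : persistence_module k R) (F G : pm_hom eps U V) :
  (forall a x, F a x = G a x) -> F = G.
Proof.
case: F G => [F Fnat] [G Gnat] /= FG.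
have EFG : F = G.
  by apply: functional_extensionality_dep => a; exact: linear_map_eq (FG a).
by subst G; congr PmHom; apply: Prop_irrelevance.
Qed.

(** * Maps subordinate to a multivalued map *)

Section Multivalued.
Variables (k : fieldType) (R : realType) (X Y : choiceType).
Variables (S : filtered_complex R X) (T : filtered_complex R Y) (eps : R).
Variable C : set (X * Y).
Hypothesis C_simp : mv_simplicial eps S T C.

Lemma subordinate_contiguous f g a :
  subordinate C f -> subordinate C g -> contiguous (S a) (T (a + eps)) f g.
Proof.
move=> Cf Cg s Ss; apply: (C_simp Ss).
  have /fset0Pn[x xs] := simplex_neq0 Ss; apply/fset0Pn; exists (f x).
  by rewrite inE; apply/orP; left; apply/imfsetP; exists x.
by move=> y /=; rewrite inE => /orP[] /imfsetP[x /= xs ->]; exists x.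
Qed.

Lemma subordinate_simplicial f a :
  subordinate C f -> simplicial (S a) (T (a + eps)) f.
Proof.
by move=> Cf s /(subordinate_contiguous Cf Cf); rewrite fsetUid.
Qed.

Definition subordinate_hom_map f (Cf : subordinate C f) a :
    {linear homology k (S a) -> homology k (T (a + eps))} :=
  homology_map (subordinate_simplicial Cf (a := a)).

Lemma subordinate_hom_natural f (Cf : subordinate C f) a b (ab : a <= b)
    (abe : a + eps <= b + eps) x :
  pm_map (persistent_homology k T) abe (subordinate_hom_map Cf a x) =
  subordinate_hom_map Cf b (pm_map (persistent_homology k S) ab x).
Proof.
(* Both composites are induced by [f] from [S a] to [T (b + eps)]. *)
have fab : simplicial (S a) (T (b + eps)) f.
  move=> s Ss; apply: (filtration_mono abe).
  exact: subordinate_simplicial Ss.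
rewrite /= /inclusion_map /subordinate_hom_map /=.
by rewrite !(homology_map_comp _ _ fab).
Qed.

Definition subordinate_hom f (Cf : subordinate C f) :
    pm_hom eps (persistent_homology k S) (persistent_homology k T) :=
  @PmHom k R eps (persistent_homology k S) (persistent_homology k T)
    (subordinate_hom_map Cf) (subordinate_hom_natural Cf).

End Multivalued.

Theorem proposition3p3 (k : fieldType) (R : realType) (X Y : choiceType)
  (S : filtered_complex R X) (T : filtered_complex R Y) (eps : R)
  (C : set (X * Y)) (C_mv : multivalued C) (C_simp : mv_simplicial eps S T C) :
  exists! HC : pm_hom eps (persistent_homology k S) (persistent_homology k T),
    forall f : X -> Y, subordinate C f ->
      exists f_simp : forall a, simplicial (S a) (T (a + eps)) f,
        forall a (x : homology k (S a)),
          HC a x = homology_map (f_simp a) x.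
Proof.
have [f0 Cf0] := choice C_mv.
exists (subordinate_hom k C_simp Cf0); split=> [f Cf|HC HCf].
  exists (fun a => subordinate_simplicial C_simp Cf (a := a)) => a x.
  apply: contiguous_homology_map.
  exact: (subordinate_contiguous C_simp).
(* A competitor is already determined by its value on the chosen [f0]. *)
have [f_simp HCf0] := HCf f0 Cf0.
apply: pm_hom_eq => a x; rewrite HCf0.
congr (homology_map _ x); exact: Prop_irrelevance.
Qed.
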